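(* Let $A$ be a Lie triple algebra over a field $K$ with a pseudo-idempotent $e$, where $e^2=e+t$, $et=\frac12 t$ and $0\neq t\in L$, and let $A=A_e(1)\oplus A_e(1/2)\oplus A_e(0)$ be the Peirce decomposition of $A$ relative to $e$. Then every derivation $d$ of $A$ is determined and only defined by a quadruplet $(d(e),f_d,g_d,h_d)$ with $f_d\in \mathrm{End}_K(A_e(1/2))$, $g_d\in \mathrm{End}_K(A_e(0))$ and $h_d\in \mathrm{End}_K(A_e(1))$ satisfying the following conditions (for all $x_\lambda,y_\lambda\in A_e(\lambda)$, $\lambda=0,\frac12,1$): (i) $d(e)\in A_e(1/2)$; (ii) $d(x_1)=h_d(x_1)+2d(e)x_1$; (iii) $d(x_{1/2})=f_d(x_{1/2})+2(d(e)x_{1/2})_0-2(d(e)x_{1/2})_1$; (iv) $d(x_0)=g_d(x_0)-2d(e)x_0$; (v) $h_d((x_1y_1)_1)=[h_d(x_1)y_1+x_1h_d(y_1)]_1$ and $f_d((x_1y_1)_{1/2})=[h_d(x_1)y_1+x_1h_d(y_1)]_{1/2}=2h_d((x_1y_1)_1)t$; (vi) $g_d((x_0y_0)_0)=[g_d(x_0)y_0+x_0g_d(y_0)]_0$ and $f_d((x_0y_0)_{1/2})=[g_d(x_0)y_0+x_0g_d(y_0)]_{1/2}=2g_d((x_0y_0)_0)t$; (vii) $h_d((x_{1/2}y_{1/2})_1)=[f_d(x_{1/2})y_{1/2}+x_{1/2}f_d(y_{1/2})]_1$ and $g_d((x_{1/2}y_{1/2})_0)=[f_d(x_{1/2})y_{1/2}+x_{1/2}f_d(y_{1/2})]_0$;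 (viii) $f_d(x_1x_0)=h_d(x_1)x_0+x_1g_d(x_0)$; (ix) $f_d(x_1x_{1/2})=h_d(x_1)x_{1/2}+x_1f_d(x_{1/2})$; (x) $f_d(x_0x_{1/2})=g_d(x_0)x_{1/2}+x_0f_d(x_{1/2})$.
   Context: A Lie triple algebra is a commutative (not necessarily associative) algebra satisfying $2x(x(xy))+yx^3=3x(yx^2)$ for all $x,y$, where $x^3=x\,x^2$. $L$ denotes the ideal of $A$ generated by all associators $(x^2,x,x)=(x^2x)x-x^2(xx)$. A pseudo-idempotent of $A$ is a non-zero element $e$ for which there is $t\ne0$ in $L$ with $e^2=e+t$ and $et=\frac12 t$. Put $A_e(\lambda)=\{x\in A: ex=\lambda x\}$ and $L_e(\lambda)=L\cap A_e(\lambda)$ for $\lambda\in\{0,\frac12,1\}$; then $A=A_e(1)\oplus A_e(1/2)\oplus A_e(0)$ (Peirce decomposition), and $t\in L_e(1/2)$. Subscripts $(\cdot)_\lambda$ or $[\cdot]_\lambda$ denote the component in $A_e(\lambda)$. It is known that $A_e(1)A_e(0)\subseteq L_e(1/2)$, that $A_e(\lambda)A_e(1/2)\subseteq A_e(1/2)$ and $A_e(\lambda)A_e(\lambda)\subseteq A_e(\lambda)+L_e(1/2)$ for $\lambda=0,1$, and that $A_e(1/2)A_e(1/2)\subseteq A_e(1)+A_e(0)$.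
   Formalization: The field K is assumed to have characteristic different from 2 (so that 1/2 exists) and from 3; in characteristic 3 the Peirce multiplication rules and condition (i), d(e) in A_e(1/2), can fail. *)

(* Defs.v *)
From HB Require Import structures.
From mathcomp Require Import all_boot all_order all_algebra.
From mathcomp Require Import boolp classical_sets.

Set Implicit Arguments.
Unset Strict Implicit.
Unset Printing Implicit Defensive.

Import GRing.Theory.
Local Open Scope ring_scope.

(* MathComp has no structure for nonassociative algebras: a K-algebra is a
   K-module A together with a bilinear product [mul]. *)

Section LieTripleAlgebra.
Variables (K : fieldType) (A : lmodType K) (mul : {bilinear A -> A -> A}).

Local Notation "x ** y" := (mul x y) (at level 40, left associativity).

Definition lie_triple_algebra : Prop :=
  commutative mul /\
  forall x y : A,
    2%:R *: (x ** (x ** (x ** y))) + y ** (x ** (x ** x))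
      = 3%:R *: (x ** (y ** (x ** x))).

Definition associator (x y z : A) : A := (x ** y) ** z - x ** (y ** z).

Record is_ideal (I : A -> Prop) : Prop := IsIdeal {
  ideal0 : I 0;
  idealD : forall x y, I x -> I y -> I (x + y);
  idealZ : forall (a : K) x, I x -> I (a *: x);
  idealMl : forall x y, I y -> I (x ** y);
  idealMr : forall x y, I x -> I (x ** y) }.

Definition assoc_ideal (x : A) : Prop :=
  forall I : A -> Prop,
    is_ideal I -> (forall y : A, I (associator (y ** y) y y)) -> I x.

(* The witness t is determined by e, since t = e^2 - e. *)
Record pseudo_idempotent (e t : A) : Prop := PseudoIdempotent {
  pi_e_neq0 : e != 0;
  pi_t_neq0 : t != 0;
  pi_t_in_L : assoc_ideal t;
  pi_sqr : e ** e = e + t;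
  pi_et : e ** t = 2%:R^-1 *: t }.

Definition derivation (d : {linear A -> A}) : Prop :=
  forall x y : A, d (x ** y) = d x ** y + x ** d y.

Definition peirce_pred (e : A) (lam : K) : {pred A} :=
  [pred x | e ** x == lam *: x].

Record peirce (e : A) (lam : K) : Type := Peirce {
  peirce_val : A;
  _ : peirce_val \in peirce_pred e lam }.

End LieTripleAlgebra.

Section PeirceSubmodule.
Variables (K : fieldType) (A : lmodType K) (mul : {bilinear A -> A -> A}).
Variables (e : A) (lam : K).

HB.instance Definition _ := [isSub for @peirce_val K A mul e lam].
HB.instance Definition _ := [Choice of peirce mul e lam by <:].

Fact peirce_submod : subsemimod_closed (peirce_pred mul e lam).
Proof.
split; [split|].
- by rewrite inE linear0r scaler0.
- move=> x y; rewrite !inE => /eqP hx /eqP hy.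
  by rewrite linearDr hx hy scalerDr.
- move=> a x; rewrite !inE => /eqP hx.
  by rewrite linearZr_LR /= hx !scalerA mulrC.
Qed.

HB.instance Definition _ :=
  GRing.SubChoice_isSubLmodule.Build K A (peirce_pred mul e lam)
    (peirce mul e lam) peirce_submod.

End PeirceSubmodule.

Notation peirce_end mul e lam := {linear peirce mul e lam -> peirce mul e lam}.

Section PeirceComponents.
Variables (K : fieldType) (A : lmodType K) (mul : {bilinear A -> A -> A}).
Variable e : A.

Local Notation "x ** y" := (mul x y) (at level 40, left associativity).

Local Notation A1 := (peirce mul e 1).
Local Notation Ah := (peirce mul e 2%:R^-1).
Local Notation A0 := (peirce mul e 0).

(* The Peirce components of [x], i.e. the triple (x1, xh, x0) with
   x = x1 + xh + x0.  There is at most one such triple when 1, 1/2, 0 are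
   distinct; the default (0, 0, 0) only serves to make the function total when
   A is not the sum of the three spaces. *)
Definition peirce_split (x : A) : A1 * Ah * A0 :=
  xget (0, 0, 0)
    [set p : A1 * Ah * A0 | x = \val p.1.1 + \val p.1.2 + \val p.2]%classic.

Definition comp1 (x : A) : A1 := (peirce_split x).1.1.
Definition comph (x : A) : Ah := (peirce_split x).1.2.
Definition comp0 (x : A) : A0 := (peirce_split x).2.

Section Quadruplet.
Variables (f : peirce_end mul e 2%:R^-1) (g : peirce_end mul e 0).
Variable h : peirce_end mul e 1.

Record described_by (d : {linear A -> A}) (a : A) : Prop := DescribedBy {
  described_e : d e = a;
  described_e_half : a \in peirce_pred mul e 2%:R^-1;
  described_1 : forall x : A1,
    d (\val x) = \val (h x) + 2%:R *: (a ** \val x);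
  described_half : forall x : Ah,
    d (\val x) = \val (f x) + 2%:R *: \val (comp0 (a ** \val x))
                            - 2%:R *: \val (comp1 (a ** \val x));
  described_0 : forall x : A0,
    d (\val x) = \val (g x) - 2%:R *: (a ** \val x) }.

(* In the last three fields the products to which f is applied lie in Ah
   (A1 A0, A1 Ah and A0 Ah are contained in Ah), so [comph] only changes their
   type. *)
Record compatible (t : A) : Prop := Compatible {
  compat1_mul11 : forall x y : A1,
    h (comp1 (\val x ** \val y))
      = comp1 (\val (h x) ** \val y + \val x ** \val (h y));
  compath_mul11 : forall x y : A1,
    f (comph (\val x ** \val y))
      = comph (\val (h x) ** \val y + \val x ** \val (h y));
  compath_mul11_t : forall x y : A1,
    \val (comph (\val (h x) ** \val y + \val x ** \val (h y)))
      = 2%:R *: (\val (h (comp1 (\val x ** \val y))) ** t);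
  compat0_mul00 : forall x y : A0,
    g (comp0 (\val x ** \val y))
      = comp0 (\val (g x) ** \val y + \val x ** \val (g y));
  compath_mul00 : forall x y : A0,
    f (comph (\val x ** \val y))
      = comph (\val (g x) ** \val y + \val x ** \val (g y));
  compath_mul00_t : forall x y : A0,
    \val (comph (\val (g x) ** \val y + \val x ** \val (g y)))
      = 2%:R *: (\val (g (comp0 (\val x ** \val y))) ** t);
  compat1_mulhh : forall x y : Ah,
    h (comp1 (\val x ** \val y))
      = comp1 (\val (f x) ** \val y + \val x ** \val (f y));
  compat0_mulhh : forall x y : Ah,
    g (comp0 (\val x ** \val y))
      = comp0 (\val (f x) ** \val y + \val x ** \val (f y));
  compat_mul10 : forall (x : A1) (y : A0),
    \val (f (comph (\val x ** \val y)))
      = \val (h x) ** \val y + \val x ** \val (g y);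
  compat_mul1h : forall (x : A1) (y : Ah),
    \val (f (comph (\val x ** \val y)))
      = \val (h x) ** \val y + \val x ** \val (f y);
  compat_mul0h : forall (x : A0) (y : Ah),
    \val (f (comph (\val x ** \val y)))
      = \val (g x) ** \val y + \val x ** \val (f y) }.

End Quadruplet.
End PeirceComponents.

(* Main.v *)
(* Put D_{x,y} = [L_x, L_y]. The Lie triple identity says that every D_{x,y} is
   a derivation. Hence Q(a,b,c,d) = (D_{a,bc} + D_{b,ca} + D_{c,ab}) d is
   symmetric in its four arguments and a derivation in each of them. Its values
   span L, and expanding Q(aa', bb', c, d) in two ways gives D_{x,y} L = 0 and
   L^2 = 0. In particular e(ty) = ty/2, which yields the Peirce decomposition,
   the multiplication rules and t A_{1/2} = 0.

   For a in A_{1/2} the inner derivation -4 D_{e,a} sends e to a and is the one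
   with quadruplet (a, 0, 0, 0). Subtracting it reduces everything to the
   derivations that kill e: they also kill t, commute with the Peirce
   projections, and f, g, h are just their restrictions. *)

Require Import Defs.
From HB Require Import structures.
From mathcomp Require Import all_boot all_order all_algebra.
From mathcomp Require Import classical_sets ring.

Set Implicit Arguments.
Unset Strict Implicit.
Unset Printing Implicit Defensive.

Import GRing.Theory.
Local Open Scope ring_scope.

(** * Linear identities over K, decided in a commutative ring *)

Definition trivext (K : fieldType) (V : lmodType K) : Type := (K * V)%type.

Section TrivialExtension.
Variables (K : fieldType) (V : lmodType K).

HB.instance Definition _ := GRing.Zmodule.on (trivext V).

Definition trivext_mul (x y : trivext V) : trivext V :=
  (x.1 * y.1, x.1 *: y.2 + y.1 *: x.2).

Fact trivext_mulA : associative trivext_mul.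
Proof.
move=> [a u] [b v] [c w]; rewrite /trivext_mul /= mulrA !scalerDr !scalerA.
by rewrite addrA (mulrC c a) (mulrC c b).
Qed.

Fact trivext_mulC : commutative trivext_mul.
Proof. by move=> [a u] [b v]; rewrite /trivext_mul /= mulrC addrC. Qed.

Fact trivext_mul1 : left_id ((1, 0) : trivext V) trivext_mul.
Proof.
by move=> [a u]; rewrite /trivext_mul /= mul1r scale1r scaler0 addr0.
Qed.

Fact trivext_mulDl : left_distributive trivext_mul +%R.
Proof.
move=> [a u] [b v] [c w]; rewrite /trivext_mul /=.
by congr (_, _); rewrite /= ?mulrDl // scalerDl scalerDr addrACA.
Qed.

HB.instance Definition _ := GRing.Zmodule_isComPzRing.Build (trivext V)
  trivext_mulA trivext_mulC trivext_mul1 trivext_mulDl.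

Definition trivext_in (x : V) : trivext V := (0, x).

Lemma trivext_inj : injective trivext_in.
Proof. by move=> x y []. Qed.

Lemma trivext0 : trivext_in 0 = 0. Proof. by []. Qed.

Lemma trivextD x y : trivext_in (x + y) = trivext_in x + trivext_in y.
Proof. by congr (_, _); rewrite addr0. Qed.

Lemma trivextN x : trivext_in (- x) = - trivext_in x.
Proof. by congr (_, _); rewrite oppr0. Qed.

Lemma trivextMn x n : trivext_in (x *+ n) = trivext_in x *+ n.
Proof. by elim: n => [|n IH]; rewrite ?mulr0n // !mulrS trivextD IH. Qed.

End TrivialExtension.

(* [ring] in the trivial extension K + V, where V is an ideal of square zero,
   decides the identities of a K-module V with integer coefficients. *)
Tactic Notation "module" :=
  rewrite /= ?scaler_nat; apply/trivext_inj;
  rewrite ?(trivextD, trivextN, trivextMn, trivext0); ring.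

Lemma eq_from_diff (V : zmodType) (x y p q : V) :
  p = q -> x - y = p - q -> x = y.
Proof. by move=> ->; rewrite subrr => /subr0_eq. Qed.

Lemma addeq (V : zmodType) (x x' y y' : V) :
  x = x' -> y = y' -> x + y = x' + y'.
Proof. by move=> -> ->. Qed.

Lemma subeq (V : zmodType) (x x' y y' : V) :
  x = x' -> y = y' -> x - y = x' - y'.
Proof. by move=> -> ->. Qed.

Lemma muleq (V : zmodType) (n : nat) (x x' : V) : x = x' -> x *+ n = x' *+ n.
Proof. by move=> ->. Qed.

(* Proves an equality that differs from [h] by a K-module identity. *)
Tactic Notation "module" ":" uconstr(h) := refine (eq_from_diff h _); module.

Lemma char_cancel (K : fieldType) (V : lmodType K) (p : nat) (x : V) :
  prime p -> p \notin [pchar K] -> x *+ p = 0 -> x = 0.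
Proof.
move=> pr_p; rewrite inE pr_p /= => nz_p; rewrite -scaler_nat => /eqP.
by rewrite scaler_eq0 (negPf nz_p) => /eqP.
Qed.

(** * Polarization of a trilinear map *)

Section Polarization.
Variables (K : fieldType) (A B : lmodType K) (F : A -> A -> A -> B).
Hypothesis FD1 : forall b c, {morph F^~ b ^~ c : x y / x + y}.
Hypothesis FD2 : forall a c, {morph (F a)^~ c : x y / x + y}.
Hypothesis FD3 : forall a b, {morph F a b : x y / x + y}.
Hypothesis F0 : forall x, F x x x = 0.

(** Expand at [a + b + c] and remove the contributions of the pairs, which vanish by expansion at
    [x + y]; six mixed terms remain. Nothing is divided. *)
Lemma polarize3 a b c :
  F a b c + F a c b + F b a c + F b c a + F c a b + F c b a = 0.
Proof.
have H x y : F x x y + F x y x + F y x x + (F x y y + F y x y + F y y x) = 0.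
  by rewrite -[RHS](F0 (x + y)) !(FD1, FD2, FD3) !F0; module.
have := F0 (a + b + c); have := H a b; have := H a c; have := H b c.
rewrite !(FD1, FD2, FD3) !F0 => H1 H2 H3 H4.
module: (subeq H4 (addeq H1 (addeq H2 H3))).
Qed.
End Polarization.

Section LieTriple.
Variables (K : fieldType) (A : lmodType K) (mul : {bilinear A -> A -> A}).
Hypothesis char2 : 2%N \notin [pchar K].
Hypothesis char3 : 3%N \notin [pchar K].
Hypothesis lieA : lie_triple_algebra mul.

Local Notation "x ** y" := (mul x y) (at level 40, left associativity).

Lemma mulC x y : x ** y = y ** x. Proof. by case: lieA. Qed.
Lemma mulDl x y z : (x + y) ** z = x ** z + y ** z.
Proof. exact: linearDl. Qed.
Lemma mulDr x y z : x ** (y + z) = x ** y + x ** z.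
Proof. exact: linearDr. Qed.
Lemma mulNl x y : (- x) ** y = - (x ** y).
Proof. exact: linearNl. Qed.
Lemma mulNr x y : x ** (- y) = - (x ** y).
Proof. exact: linearNr. Qed.
Lemma mulMnl x y n : (x *+ n) ** y = (x ** y) *+ n.
Proof. exact: linearMnl. Qed.
Lemma mulMnr x y n : x ** (y *+ n) = (x ** y) *+ n.
Proof. exact: linearMnr. Qed.
Lemma mulZr a x y : x ** (a *: y) = a *: (x ** y).
Proof. exact: linearZr_LR. Qed.
Lemma mul0l x : 0 ** x = 0. Proof. exact: linear0l. Qed.
Lemma mul0r x : x ** 0 = 0. Proof. exact: linear0r. Qed.

Definition mulE := (mulDl, mulDr, mulNl, mulNr, mulMnl, mulMnr, mul0l, mul0r).

Lemma double_inj (x : A) : x *+ 2 = 0 -> x = 0.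
Proof. exact: char_cancel. Qed.
Lemma triple_inj (x : A) : x *+ 3 = 0 -> x = 0.
Proof. exact: char_cancel. Qed.

Lemma double_eq (x y : A) : x *+ 2 = y *+ 2 -> x = y.
Proof.
by move=> h; apply/subr0_eq/double_inj; rewrite mulrnBl h subrr.
Qed.

(** * The commutators [L_x, L_y] and their Leibniz rule *)

Definition der (x y z : A) : A := x ** (y ** z) - y ** (x ** z).

Definition leibniz_defect (x y z w : A) : A :=
  der x y (z ** w) - der x y z ** w - z ** der x y w.

Lemma derC x y z : der x y z = - der y x z.
Proof. by rewrite /der opprB. Qed.

Lemma leibniz_defectN x y z w :
  leibniz_defect x y z w = - leibniz_defect y x z w.
Proof. rewrite /leibniz_defect !(derC y x) !mulE; module. Qed.

Lemma leibniz_defectC x y z w :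
  leibniz_defect x y z w = leibniz_defect x y w z.
Proof.
rewrite /leibniz_defect (mulC w z) (mulC w (der x y z)) (mulC (der x y w)).
by rewrite addrAC.
Qed.

(** The Lie triple identity says [leibniz_defect x y x x = 0]. Polarized in x it has six terms,
    equal in pairs by symmetry in the last two arguments; hence the division by 2. *)
Lemma leibniz_defect_cycle y a b c :
  leibniz_defect a y b c + leibniz_defect b y c a + leibniz_defect c y a b = 0.
Proof.
apply: double_inj.
have := @polarize3 K A A (fun x z w => leibniz_defect x y z w).
move=> /(_ _ _ _ _ a b c) <-.
- rewrite (leibniz_defectC a y c b) (leibniz_defectC b y a c).
  by rewrite (leibniz_defectC c y b a); module.
- by move=> z w x x' /=; rewrite /leibniz_defect /der !mulE; module.
- by move=> x w z z' /=; rewrite /leibniz_defect /der !mulE; module.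
- by move=> x z w w' /=; rewrite /leibniz_defect /der !mulE; module.
move=> x; case: lieA => _ /(_ x y); rewrite /leibniz_defect /der !mulE.
rewrite (mulC (x ** (y ** x)) x) (mulC (y ** (x ** x)) x) (mulC y x).
by move=> h; module: (esym h).
Qed.

(* The part of the multilinear Lie triple identity that is alternating in three
   of its variables vanishes in every commutative algebra. *)
Lemma leibniz_defect_alternating a b c d :
  leibniz_defect a b c d + leibniz_defect b c a d + leibniz_defect c a b d = 0.
Proof.
rewrite /leibniz_defect /der !mulE.
rewrite (mulC b a) (mulC c a) (mulC c b).
rewrite !(mulC _ d).
module.
Qed.

Lemma der_leibniz a b c d :
  der a b (c ** d) = der a b c ** d + c ** der a b d.
Proof.
suff: leibniz_defect a b c d = 0.
  by rewrite /leibniz_defect => h; module: h.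
(* In [h1 + h2 + h3 - h4] the defect of [a b c d] occurs four times and all other defects cancel. *)
apply/double_inj/double_inj.
have h1 := leibniz_defect_alternating a b c d.
have h2 := leibniz_defect_alternating a b d c.
have h3 := leibniz_defect_cycle b a c d.
have h4 := leibniz_defect_cycle a b c d.
rewrite (leibniz_defectC a b d c) in h2.
rewrite (leibniz_defectN c b) (leibniz_defectC b c d a) in h3.
rewrite (leibniz_defectN b a) (leibniz_defectC c a d b) in h4.
rewrite (leibniz_defectN d a) (leibniz_defectC b d a c) in h2.
rewrite (leibniz_defectN d b) (leibniz_defectC b d a c) in h3.
rewrite (leibniz_defectC d a b c) (leibniz_defectN d a) in h4.
rewrite !(leibniz_defectC b d c a) (leibniz_defectC a d c b) in h2 h3 h4.
module: (addeq h1 (addeq h2 (subeq h3 h4))).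
Qed.

(** * The symmetric quadrilinear map [quad] *)

(* Up to the factor 3, the polarization of the associator (x^2, x, x) in four
   variables. *)
Definition quad (a b c d : A) : A :=
  der a (b ** c) d + der b (c ** a) d + der c (a ** b) d.

Lemma quadC12 a b c d : quad a b c d = quad b a c d.
Proof.
by rewrite /quad (mulC c b) (mulC a c) (mulC b a); module.
Qed.

Lemma quadC23 a b c d : quad a b c d = quad a c b d.
Proof.
by rewrite /quad (mulC c b) (mulC a c) (mulC b a); module.
Qed.

(** In expanded form this is the Leibniz rule of D_{c,d} on [a ** b]. With [quadC12] and [quadC23]
    it gives total symmetry. *)
Lemma quadC34 a b c d : quad a b c d = quad a b d c.
Proof.
have h := der_leibniz c d a b.
rewrite (mulC _ b) in h.
rewrite /quad /der in h *; rewrite !mulE in h *.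
rewrite (mulC c a) (mulC d a) (mulC b a) (mulC c b) (mulC d b) in h *.
rewrite (mulC d c) in h *.
rewrite (mulC (c ** (a ** d)) b) (mulC (d ** (a ** c)) b) in h.
rewrite (mulC (b ** d)) (mulC (b ** c)) (mulC (a ** c) d) (mulC (a ** d) c).
rewrite (mulC (a ** b) d) (mulC (a ** b) c).
rewrite (mulC (b ** d) (a ** c)) (mulC (b ** c) (a ** d)).
by module: h.
Qed.

Lemma quad_leibniz4 a b c d d' :
  quad a b c (d ** d') = quad a b c d ** d' + d ** quad a b c d'.
Proof. by rewrite /quad !der_leibniz !mulE; module. Qed.

Lemma quad_leibniz1 a a' b c d :
  quad (a ** a') b c d = quad a b c d ** a' + a ** quad a' b c d.
Proof.
have rot x y z w : quad x y z w = quad y z w x.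
  by rewrite quadC12 quadC23 quadC34.
by rewrite rot quad_leibniz4 (rot a) (rot a').
Qed.

Lemma quad_leibniz2 a b b' c d :
  quad a (b ** b') c d = quad a b c d ** b' + b ** quad a b' c d.
Proof. by rewrite quadC12 quad_leibniz1 (quadC12 b) (quadC12 b'). Qed.

(** Makes the span of the values of [quad] an ideal. By Leibniz in the products [x ** a], [x ** b],
    [a ** b], all terms cancel but two copies of [x ** quad a b c d]. *)
Lemma mul_quad a b c d x :
  (x ** quad a b c d) *+ 2 =
  quad (x ** a) b c d + quad a (x ** b) c d - quad (a ** b) x c d.
Proof.
rewrite !quad_leibniz1 quad_leibniz2 (mulC a) (quadC12 b x).
rewrite (mulC (quad a x c d)).
by module.
Qed.

(* Expand [quad (a a') (b b') c d] by Leibniz in either order. *)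
Lemma der_quad_exchange a a' b b' c d :
  der a b (quad a' b' c d) + der a b' (quad a' b c d)
  + der a' b (quad a b' c d) + der a' b' (quad a b c d) = 0.
Proof.
have := quad_leibniz2 (a ** a') b b' c d.
rewrite [LHS]quad_leibniz1 !quad_leibniz2 !quad_leibniz1.
move: (quad a b c d) (quad a b' c d) (quad a' b c d) (quad a' b' c d).
move=> p q r s; rewrite /der !mulE.
rewrite (mulC (p ** b')) (mulC p b') (mulC (b ** q)) (mulC r b').
rewrite (mulC (p ** a')) (mulC p a') (mulC (a ** r)) (mulC q a') => h.
module: h.
Qed.

(** Add the exchange relations for the cyclic shifts of a, b, c: terms whose derivation does not
    involve d cancel by antisymmetry, the others occur twice. *)
Lemma der_quad_cycle d a b c x y :
  der a d (quad b c x y) + der b d (quad c a x y) + der c d (quad a b x y) = 0.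
Proof.
apply: double_inj.
have h1 := der_quad_exchange a b c d x y.
have h2 := der_quad_exchange b c a d x y.
have h3 := der_quad_exchange c a b d x y.
rewrite (quadC12 a c) in h1.
rewrite (derC b a) (derC c a) (quadC12 b a) in h2.
rewrite (derC c b) (quadC12 c b) in h3.
module: (addeq h1 (addeq h2 h3)).
Qed.

(* With [x] and [y] fixed, the five values of [der i x (quad ...)] obtained by
   taking i out of {a, b, c, d, y} have all their three-term sums equal to 0. *)
Lemma der_quad a x b c d y : der a x (quad b c d y) = 0.
Proof.
apply: triple_inj.
have h1 := der_quad_cycle x a b c d y.
have h2 := der_quad_cycle x a b d c y.
have h3 := der_quad_cycle x a c d b y.
have h4 := der_quad_cycle x b c d a y.
rewrite (quadC12 c a) in h1.
rewrite (quadC23 b d) (quadC12 d a) (quadC23 a d) in h2.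
rewrite (quadC23 c d) (quadC12 c b) (quadC12 d a) in h3.
rewrite (quadC23 a d) (quadC23 a c) in h3.
rewrite (quadC23 c d) (quadC12 c a) (quadC23 d b) (quadC12 d a) in h4.
rewrite (quadC23 a d) (quadC23 b c) (quadC12 b a) in h4.
module: (subeq (addeq h1 (addeq h2 h3)) (muleq 2 h4)).
Qed.

(** * The ideal L: killed by every [der], and of square zero *)

Definition submod_pred (S : A -> Prop) : Prop :=
  [/\ S 0, forall x y, S x -> S y -> S (x + y) &
      forall k x, S x -> S (k *: x)].

(** The span as an intersection of submodules: a linear condition passes to it from the generators
    by mere application. *)
Definition quad_span (z : A) : Prop := forall S : A -> Prop,
  submod_pred S -> (forall a b c d, S (quad a b c d)) -> S z.

Lemma quad_span_submod : submod_pred quad_span.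
Proof.
split=> [S [] // | u v Iu Iv S Ssub SQ | k u Iu S Ssub SQ].
  by have [_ SD _] := Ssub; exact: SD _ _ (Iu S Ssub SQ) (Iv S Ssub SQ).
by have [_ _ SZ] := Ssub; exact: SZ _ _ (Iu S Ssub SQ).
Qed.

Lemma quad_in_span a b c d : quad_span (quad a b c d).
Proof. by move=> S _; apply. Qed.

Lemma quad_span_divn n u :
  prime n -> n \notin [pchar K] -> quad_span (u *+ n) -> quad_span u.
Proof.
move=> pr_n; rewrite inE pr_n /= => nz_n.
have [_ _ spanZ] := quad_span_submod; move/(spanZ n%:R^-1).
by rewrite -scaler_nat scalerA mulVf // scale1r.
Qed.

Lemma quad_span_ideal : is_ideal mul quad_span.
Proof.
have [span0 spanD spanZ] := quad_span_submod.
have spanM u v : quad_span v -> quad_span (u ** v).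
  move=> Iv; apply: (Iv (fun v => quad_span (u ** v))); first split.
  - by rewrite mul0r.
  - by move=> y z Iy Iz; rewrite mulDr; apply: spanD.
  - by move=> k y Iy; rewrite mulZr; apply: spanZ.
  move=> a b c d; apply: (quad_span_divn (n := 2)) => //; rewrite mul_quad.
  rewrite -scaleN1r; apply: (spanD); last by apply: spanZ; apply: quad_in_span.
  by apply: spanD; apply: quad_in_span.
by split=> // u v Iu; rewrite mulC; apply: spanM.
Qed.

(** The three summands of [quad y y y y] all equal the associator of y^2, y, y, and 3 is
    invertible. *)
Lemma assoc_ideal_span x : assoc_ideal mul x -> quad_span x.
Proof.
move=> Lx; apply: (Lx quad_span quad_span_ideal) => y.
apply: (quad_span_divn (n := 3)) => //.
suff -> : associator mul (y ** y) y y *+ 3 = quad y y y y.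
  exact: quad_in_span.
by rewrite /associator /quad /der (mulC _ y) (mulC _ y); module.
Qed.

Lemma der_assoc_ideal x y z : assoc_ideal mul z -> der x y z = 0.
Proof.
move/assoc_ideal_span => /(_ (fun z => der x y z = 0)).
apply; last exact: der_quad; split.
- by rewrite /der !mulE; module.
- by move=> u v; rewrite /der !mulE => hu hv; module: (addeq hu hv).
by move=> k u; rewrite /der !mulZr -scalerBr => ->; rewrite scaler0.
Qed.

Lemma assoc_ideal_mulAC x y z :
  assoc_ideal mul z -> x ** (y ** z) = y ** (x ** z).
Proof. by move/(der_assoc_ideal x y)/subr0_eq. Qed.

Lemma assoc_ideal_is_ideal : is_ideal mul (assoc_ideal mul).
Proof.
split.
- by move=> I [].
- by move=> u v Lu Lv I Iid Ia;
  exact: (Defs.idealD Iid) (Lu I Iid Ia) (Lv I Iid Ia).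
- by move=> k u Lu I Iid Ia; apply: (Defs.idealZ Iid); exact: (Lu I Iid Ia).
- by move=> u v Lv I Iid Ia; apply: (Defs.idealMl Iid); exact: (Lv I Iid Ia).
- by move=> u v Lu I Iid Ia; apply: (Defs.idealMr Iid); exact: (Lu I Iid Ia).
Qed.

(** For v a value of [quad], [mul_quad] turns 2uv into values of [quad] with one argument in L. By
    symmetry that argument may stand last, where every [der] kills it. *)
Lemma assoc_ideal_sqr u v :
  assoc_ideal mul u -> assoc_ideal mul v -> u ** v = 0.
Proof.
move=> Lu /assoc_ideal_span => /(_ (fun v => u ** v = 0)); apply; first split.
- by rewrite mul0r.
- by move=> x y hx hy; rewrite mulDr hx hy addr0.
- by move=> k x hx; rewrite mulZr hx scaler0.
move=> a b c d.
apply: double_inj; rewrite mul_quad.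
have quad0 x y z w : assoc_ideal mul x -> quad x y z w = 0.
  by move=> Lx; rewrite quadC12 quadC23 quadC34 /quad !der_assoc_ideal ?addr0.
have LM x : assoc_ideal mul (u ** x).
  exact: (Defs.idealMr assoc_ideal_is_ideal).
by rewrite !(quadC12 a) !(quadC12 (a ** b)) !quad0 // addr0 subr0.
Qed.

(** * Peirce projections of a pseudo-idempotent *)

Section PseudoIdempotent.
Variables e t : A.
Hypothesis pseudo_e : pseudo_idempotent mul e t.

Local Notation L := (assoc_ideal mul).

Let Lt : L t. Proof. by case: pseudo_e. Qed.
Let ee : e ** e = e + t. Proof. by case: pseudo_e. Qed.

Let nz2 : 2%:R != 0 :> K.
Proof. by move: char2; rewrite inE. Qed.

(** Clears the fraction, since [module] handles integer coefficients only. *)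
Lemma half_eigen x : (e ** x == 2%:R^-1 *: x) = ((e ** x) *+ 2 == x).
Proof.
rewrite -scaler_nat -(inj_eq (scalerI nz2)) scalerA mulfV // scale1r.
by [].
Qed.

Let et : (e ** t) *+ 2 = t.
Proof. by apply/eqP; rewrite -half_eigen; apply/eqP; case: pseudo_e. Qed.

(** L_e and L_x commute on L, so the eigenvalue 1/2 of u passes to its multiples. *)
Lemma assoc_ideal_half u x :
  L u -> (e ** u) *+ 2 = u -> (e ** (u ** x)) *+ 2 = u ** x.
Proof.
by move=> Lu eu; rewrite (mulC u) (assoc_ideal_mulAC _ _ Lu) -mulMnr eu.
Qed.

Lemma mul_t_half x : (e ** (t ** x)) *+ 2 = t ** x.
Proof. exact: assoc_ideal_half. Qed.

(** The Lie triple identity at e. As e^3 = e + (3/2)t and e(tx) = tx/2, the terms in t cancel,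
    leaving the polynomial 2X^3 - 3X^2 + X in L_e, with roots 0, 1/2, 1. *)
Lemma mul_e_cubic x :
  (e ** (e ** (e ** x))) *+ 2 + e ** x = (e ** (e ** x)) *+ 3.
Proof.
apply: double_eq.
have [_ /(_ e x)] := lieA; rewrite ee (mulC x (e + t)) (mulC x) !mulE ee !mulDl.
have ht := mul_t_half x.
have h2 : (e ** t ** x) *+ 2 = t ** x by rewrite -mulMnl et.
move=> h; module: (addeq (muleq 2 h) (subeq (muleq 3 ht) h2)).
Qed.

Definition in1 x := e ** x = x.
Definition inh x := (e ** x) *+ 2 = x.
Definition in0 x := e ** x = 0.

(* The Lagrange polynomials of the nodes 1, 1/2, 0 evaluated at L_e. *)
Definition pr1 x := (e ** (e ** x)) *+ 2 - e ** x.
Definition prh x := (e ** x - e ** (e ** x)) *+ 4.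
Definition pr0 x := x - (e ** x) *+ 3 + (e ** (e ** x)) *+ 2.

Lemma pr_sum x : x = pr1 x + prh x + pr0 x.
Proof. by rewrite /pr1 /prh /pr0; module. Qed.

Lemma in1_pr1 x : in1 (pr1 x).
Proof. by rewrite /in1 /pr1 !mulE; module: (mul_e_cubic x). Qed.
Lemma inh_prh x : inh (prh x).
Proof.
rewrite /inh /prh !mulE; module: (muleq 4 (esym (mul_e_cubic x))).
Qed.
Lemma in0_pr0 x : in0 (pr0 x).
Proof. by rewrite /in0 /pr0 !mulE; module: (mul_e_cubic x). Qed.

(** Through j = y/4 the fractions 1/2 and 1/4 produced by L_e and its square disappear, so that
    [module] applies. *)
Lemma inh_quarter y : inh y ->
  exists j, [/\ y = j *+ 4, e ** y = j *+ 2 & e ** (e ** y) = j].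
Proof.
move=> hy; have hy2 : (e ** (e ** y)) *+ 2 = e ** y by rewrite -mulMnr hy.
exists (e ** (e ** y)); split => //.
by module: (esym (addeq (muleq 2 hy2) hy)).
Qed.

Lemma pr_in1 x : in1 x -> [/\ pr1 x = x, prh x = 0 & pr0 x = 0].
Proof. by rewrite /pr1 /prh /pr0 => hx; rewrite !hx; split; module. Qed.
Lemma pr_in0 x : in0 x -> [/\ pr1 x = 0, prh x = 0 & pr0 x = x].
Proof.
by rewrite /pr1 /prh /pr0 => hx; rewrite !hx !mulE; split; module.
Qed.
Lemma pr_inh x : inh x -> [/\ pr1 x = 0, prh x = x & pr0 x = 0].
Proof.
rewrite /pr1 /prh /pr0 => /inh_quarter [j [-> h1 h2]].
rewrite h2 h1.
by split; module.
Qed.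

Lemma pr_linear (k : K) x y :
  [/\ pr1 (k *: x + y) = k *: pr1 x + pr1 y,
      prh (k *: x + y) = k *: prh x + prh y &
      pr0 (k *: x + y) = k *: pr0 x + pr0 y].
Proof.
rewrite /pr1 /prh /pr0 !(mulDr, mulZr).
rewrite !(scalerBr, scalerDr, =^~ scalerMnr).
by split; module.
Qed.

(** * Multiplication rules of the Peirce spaces *)

(** The Leibniz rule of D_{e,y} on [e ** z], from which the product rules below are read off. *)
Lemma der_e_mul y z :
  (e ** (y ** (e ** z))) *+ 2 + (e ** y) ** z + (t ** y) ** z =
  e ** (e ** (y ** z)) + y ** (e ** (e ** z)) + (e ** (e ** y)) ** z.
Proof.
have := der_leibniz e y e z; rewrite /der ee !mulE (mulC y e) (mulC y t) => h.
module: h.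
Qed.

Lemma mul_tt_half y z : (e ** ((t ** y) ** z)) *+ 2 = (t ** y) ** z.
Proof.
apply: assoc_ideal_half; last exact: mul_t_half.
exact: (Defs.idealMr assoc_ideal_is_ideal).
Qed.

Lemma mul_tAC y z : (t ** y) ** z = (t ** z) ** y.
Proof.
by rewrite mulC (mulC t y) (assoc_ideal_mulAC z y Lt) (mulC z t) mulC.
Qed.

Lemma mul_tt x : t ** x ** t = 0.
Proof.
apply: assoc_ideal_sqr => //; exact: (Defs.idealMr assoc_ideal_is_ideal).
Qed.

(** Here [der_e_mul] reads (L_e - 1)^2 (yz) = (ty)z, with right side in A_{1/2}. On the component of
    eigenvalue c the operator is (c - 1)^2: the 0-component vanishes, and 4 is the inverse of (1/2 -
    1)^2. In [mul00] the operator is L_e^2. *)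
Lemma mul11 y z : in1 y -> in1 z ->
  pr0 (y ** z) = 0 /\ prh (y ** z) = (t ** y ** z) *+ 4.
Proof.
rewrite /in1 /prh /pr0 => hy hz; have := der_e_mul y z; rewrite !hy !hz.
have ht := mul_tt_half y z; have hc := mul_e_cubic (y ** z).
move: (y ** z) (t ** y ** z) ht hc => w s ht hc h.
have he := congr1 (mul e) h; rewrite !mulE in he.
have hs := subeq (addeq (muleq 2 he) hc) ht.
by split; [module: (subeq hs h) | module: (muleq 4 (esym hs))].
Qed.

Lemma mul00 y z : in0 y -> in0 z ->
  pr1 (y ** z) = 0 /\ prh (y ** z) = (t ** y ** z) *+ 4.
Proof.
rewrite /in0 /prh /pr1 => hy hz; have := der_e_mul y z; rewrite !hy !hz !mulE.
have ht := mul_tt_half y z; have hc := mul_e_cubic (y ** z).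
move: (y ** z) (t ** y ** z) ht hc => w s ht hc h.
have he := congr1 (mul e) h; rewrite !mulE in he.
have hs := subeq (addeq (muleq 2 he) hc) ht.
split; first by module: (esym (subeq hs h)).
by module: (muleq 4 (subeq hs (muleq 2 h))).
Qed.

(** Use [der_e_mul] for (y, z) and for (z, y): the terms (ty)z and e(e(yz)) are symmetric and cancel
    in the difference. The next two lemmas follow the same way. *)
Lemma mul10 y z : in1 y -> in0 z -> inh (y ** z).
Proof.
rewrite /in1 /in0 /inh => hy hz.
have h1 := der_e_mul y z; have h2 := der_e_mul z y.
rewrite mul_tAC (mulC z y) in h2; rewrite !hz !hy !mulE in h1 h2.
rewrite (mulC z y) in h2.
by module: (subeq h2 h1).
Qed.

Lemma mul1h y z : in1 y -> inh z -> inh (y ** z).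
Proof.
rewrite /in1 /inh => hy /inh_quarter [j [hz ez eez]].
have h1 := der_e_mul y z; have h2 := der_e_mul z y.
rewrite mul_tAC (mulC z y) in h2; rewrite eez ez !hy hz !mulE in h1 h2 *.
rewrite (mulC j y) in h2.
by module: (muleq 2 (subeq h2 h1)).
Qed.

Lemma mul0h y z : in0 y -> inh z -> inh (y ** z).
Proof.
rewrite /in0 /inh => hy /inh_quarter [j [hz ez eez]].
have h1 := der_e_mul y z; have h2 := der_e_mul z y.
rewrite mul_tAC (mulC z y) in h2; rewrite eez ez !hy hz !mulE in h1 h2 *.
rewrite (mulC j y) in h2.
by module: (muleq 2 (subeq h1 h2)).
Qed.

Lemma mulhh_aux y z : inh y -> inh z ->
  e ** (y ** z) + t ** y ** z = e ** (e ** (y ** z)).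
Proof.
move=> /inh_quarter [i [hy ey eey]] /inh_quarter [j [hz ez eez]].
have := der_e_mul y z; rewrite eez ez eey ey; move: (t ** y ** z) => s.
rewrite hy hz !mulE => h; module: h.
Qed.

(** For z = t the term (ty)t vanishes, so [mulhh_aux] gives e(yt) = e(e(yt)). Since yt has
    eigenvalue 1/2, it is zero. *)
Lemma mul_th y : inh y -> t ** y = 0.
Proof.
move=> hy; have := mulhh_aux hy et.
have := mul_t_half y; rewrite (mulC y t) mul_tt addr0.
case/inh_quarter=> [j [-> -> ->]] h.
by module: (muleq 4 h).
Qed.

Lemma mulhh y z : inh y -> inh z -> prh (y ** z) = 0.
Proof.
move=> hy hz; have := mulhh_aux hy hz.
by rewrite /prh (mul_th hy) mul0l addr0 => <-; module.
Qed.

(** The Leibniz rule of D_{t,y} on [e ** z], where L_e acts as 1/2 on all multiples of t and (tz)y =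
    (ty)z. *)
Lemma mul_t_11 y z : in1 y -> in1 z -> t ** (y ** z) = (t ** y ** z) *+ 2.
Proof.
rewrite /in1 => hy hz; have := der_leibniz t y e z.
rewrite /der !mulE hz (mulC y e) hy (mulC t e) (mulC y (e ** t)).
rewrite (mulC y (t ** z)).
rewrite (mul_tAC z y).
have h1 := mul_tt_half y z.
have h2 := mul_t_half (y ** z).
have h3 : (e ** t ** y ** z) *+ 2 = t ** y ** z by rewrite -2!mulMnl et.
by move=> h; module: (addeq (muleq 2 h) (subeq h2 (addeq h1 h3))).
Qed.

Lemma mul_t_00 y z : in0 y -> in0 z -> t ** (y ** z) = (t ** y ** z) *+ 2.
Proof.
rewrite /in0 => hy hz; have := der_leibniz t y e z.
rewrite /der !mulE hz (mulC y e) hy (mulC t e) (mulC y (e ** t)).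
rewrite (mulC y (t ** z)) !mulE.
rewrite (mul_tAC z y).
have h1 := mul_tt_half y z.
have h2 := mul_t_half (y ** z).
have h3 : (e ** t ** y ** z) *+ 2 = t ** y ** z by rewrite -2!mulMnl et.
by move=> h; module: (addeq (muleq 2 (esym h)) (subeq (addeq h1 h3) h2)).
Qed.

(** Both sides equal 4(ty)z, because t kills the A_{1/2}-component of yz. This is the source of
    [compath_mul11_t]. *)
Lemma prh_mul11 y z : in1 y -> in1 z ->
  prh (y ** z) = (pr1 (y ** z) ** t) *+ 2.
Proof.
move=> hy hz; have [p0 ph] := mul11 hy hz.
rewrite ph (mulC (_ (y ** z)) t); have := mul_t_11 hy hz.
rewrite {1}(pr_sum (y ** z)) p0 addr0 mulDr (mul_th (inh_prh _)) addr0 => ->.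
by module.
Qed.

Lemma prh_mul00 y z : in0 y -> in0 z ->
  prh (y ** z) = (pr0 (y ** z) ** t) *+ 2.
Proof.
move=> hy hz; have [p1 ph] := mul00 hy hz.
rewrite ph (mulC (_ (y ** z)) t); have := mul_t_00 hy hz.
rewrite {1}(pr_sum (y ** z)) p1 add0r mulDr (mul_th (inh_prh _)) add0r => ->.
by module.
Qed.

(** Put u = d(e). Applying d to e^2 = e + t gives d(t) = (2L_e - 1)u, and then 2et = t gives 2tu +
    (2L_e - 1)^2 u = 0. The first term lies in A_{1/2}, the second in A_1 + A_0, so both vanish and
    u lies in A_{1/2}. *)
Lemma derivation_half d : derivation mul d -> inh (d e) /\ d t = 0.
Proof.
move=> dM; have h1 := dM e e; have h2 := congr1 d et.
rewrite ee linearD /= (mulC (d e)) in h1.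
have dt : d t = (e ** d e) *+ 2 - d e by module: h1.
rewrite linearMn /= dM dt !mulE (mulC (d e)) in h2.
have h3 := congr1 (mul e) h2; rewrite !mulE in h3.
have ht := mul_t_half (d e); have hc := mul_e_cubic (d e).
have hd : inh (d e).
  rewrite /inh.
  module: (subeq (muleq 2 h3) (addeq h2 (addeq (muleq 2 ht) (muleq 4 hc)))).
by rewrite dt hd subrr.
Qed.

(* The derivation - 4 [L_e, L_a]. *)
Definition inner (a x : A) : A := (a ** (e ** x) - e ** (a ** x)) *+ 4.

Lemma inner_linear a : linear (inner a).
Proof.
move=> k x y; rewrite /inner !(mulDr, mulZr) !(scalerBr, =^~ scalerMnr).
by module.
Qed.

Lemma inner_derivation a x y :
  inner a (x ** y) = inner a x ** y + x ** inner a y.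
Proof.
have := der_leibniz a e x y; rewrite /der /inner !mulE => h.
by module: (muleq 4 h).
Qed.

Lemma inner_e a : inh a -> inner a e = a.
Proof.
move=> ha; rewrite /inner ee mulDr (mulC a t) (mul_th ha) addr0 (mulC a).
by case/inh_quarter: ha => j [-> -> ->]; module.
Qed.

Lemma inner1 a x : inh a -> in1 x -> inner a x = (a ** x) *+ 2.
Proof.
move=> ha hx; rewrite /inner hx (mulC a x).
by module: (muleq 2 (esym (mul1h hx ha))).
Qed.

Lemma inner0 a x : inh a -> in0 x -> inner a x = - ((a ** x) *+ 2).
Proof.
move=> ha hx; rewrite /inner hx (mulC a x) mulE.
by module: (muleq 2 (esym (mul0h hx ha))).
Qed.

Lemma innerh a x : inh a -> inh x ->
  inner a x = (pr0 (a ** x)) *+ 2 - (pr1 (a ** x)) *+ 2.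
Proof.
move=> ha hx.
have := mulhh ha hx; rewrite /inner /pr0 /pr1 /prh.
case/inh_quarter: hx => j [-> -> _]; rewrite !mulE => h.
by module.
Qed.

(** * From eigenvectors to the Peirce subtypes *)

Lemma linear_bundle (U V : lmodType K) (F : U -> V) :
  linear F -> exists D : {linear U -> V}, D =1 F.
Proof.
move=> linF.
pose M := GRing.isLinear.Build K U V *:%R F linF.
by exists (HB.pack_for {linear U -> V} F M).
Qed.

Lemma restrict_end (D : {linear A -> A}) lam :
  (forall x, D (e ** x) = e ** D x) ->
  exists f : peirce_end mul e lam, forall x, \val (f x) = D (\val x).
Proof.
move=> De.
have stable (x : peirce mul e lam) : D (\val x) \in peirce_pred mul e lam.
  by rewrite inE -De (eqP (valP x)) linearZ.
have [f hf] : exists f : peirce_end mul e lam,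
    f =1 fun x => Peirce (stable x).
  by apply: linear_bundle => k x y; apply: val_inj; rewrite /= linearP.
by exists f => x; rewrite hf.
Qed.

Local Notation A1 := (peirce mul e 1).
Local Notation Ah := (peirce mul e 2%:R^-1).
Local Notation A0 := (peirce mul e 0).
Local Notation comp1 := (comp1 mul e).
Local Notation comph := (comph mul e).
Local Notation comp0 := (comp0 mul e).

Lemma peirce1P x : reflect (in1 x) (x \in peirce_pred mul e 1).
Proof. by rewrite inE scale1r; apply: eqP. Qed.
Lemma peircehP x : reflect (inh x) (x \in peirce_pred mul e 2%:R^-1).
Proof. by rewrite inE half_eigen; apply: eqP. Qed.
Lemma peirce0P x : reflect (in0 x) (x \in peirce_pred mul e 0).
Proof. by rewrite inE scale0r; apply: eqP. Qed.

Lemma val_in1 (x : A1) : in1 (\val x). Proof. exact/peirce1P/valP. Qed.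
Lemma val_inh (x : Ah) : inh (\val x). Proof. exact/peircehP/valP. Qed.
Lemma val_in0 (x : A0) : in0 (\val x). Proof. exact/peirce0P/valP. Qed.

Lemma pr_eigen (x : A1) (y : Ah) (z : A0) : let s := \val x + \val y + \val z in
  [/\ pr1 s = \val x, prh s = \val y & pr0 s = \val z].
Proof.
move=> s; rewrite /s {s}.
have [x1 xh x0] := pr_in1 (val_in1 x).
have [y1 yh y0] := pr_inh (val_inh y).
have [z1 zh z0] := pr_in0 (val_in0 z).
have [] := pr_linear 1 (\val x + \val y) (\val z).
have [] := pr_linear 1 (\val x) (\val y).
rewrite !scale1r z1 zh z0 y1 yh y0 x1 xh x0 => -> -> -> -> -> -> /=.
by rewrite !(addr0, add0r).
Qed.

(** The projections provide a splitting, so the default of [xget] never occurs, and by [pr_eigen]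
    any splitting coincides with theirs. *)
Lemma peirce_splitE x :
  [/\ \val (comp1 x) = pr1 x, \val (comph x) = prh x & \val (comp0 x) = pr0 x].
Proof.
rewrite /Defs.comp1 /Defs.comph /Defs.comp0 /peirce_split.
case: xgetP => [[[u v] w] _ /= -> |]; first by have [] := pr_eigen u v w.
have x1 := introT (peirce1P _) (in1_pr1 x).
have xh := introT (peircehP _) (inh_prh x).
have x0 := introT (peirce0P _) (in0_pr0 x).
by move=> /(_ (Peirce x1, Peirce xh, Peirce x0)); case; apply: pr_sum.
Qed.

Lemma val_comp1 x : \val (comp1 x) = pr1 x.
Proof. by case: (peirce_splitE x). Qed.
Lemma val_comph x : \val (comph x) = prh x.
Proof. by case: (peirce_splitE x). Qed.
Lemma val_comp0 x : \val (comp0 x) = pr0 x.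
Proof. by case: (peirce_splitE x). Qed.

Lemma comp_sum x : x = \val (comp1 x) + \val (comph x) + \val (comp0 x).
Proof. by rewrite val_comp1 val_comph val_comp0 -pr_sum. Qed.

Lemma val_lin lam k (x y : peirce mul e lam) :
  \val (k *: x + y) = k *: \val x + \val y.
Proof. exact: linearP. Qed.

(** * Quadruplets and derivations *)

Section Quadruplets.
Variables (D : {linear A -> A}) (f : peirce_end mul e 2%:R^-1).
Variables (g : peirce_end mul e 0) (h : peirce_end mul e 1).
Hypothesis De0 : D e = 0.
Hypothesis fE : forall x, \val (f x) = D (\val x).
Hypothesis gE : forall x, \val (g x) = D (\val x).
Hypothesis hE : forall x, \val (h x) = D (\val x).

Lemma described_inner (d : {linear A -> A}) a :
  inh a -> (forall x, d x = D x + inner a x) -> described_by f g h d a.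
Proof.
move=> ha dE; split.
- by rewrite dE De0 add0r inner_e.
- exact/peircehP.
- by move=> x; rewrite dE hE (inner1 ha (val_in1 x)) scaler_nat.
- move=> x; rewrite dE fE (innerh ha (val_inh x)) !scaler_nat.
  by rewrite val_comp0 val_comp1 addrA.
- by move=> x; rewrite dE gE (inner0 ha (val_in0 x)) scaler_nat.
Qed.

(** [D] commutes with L_e, hence with the projections, which are polynomials in L_e. The conditions
    are then projected Leibniz rules; those in t come from [prh_mul11] and [prh_mul00]. *)
Lemma compatible_derivation :
  derivation mul D -> D t = 0 -> compatible f g h t.
Proof.
move=> DM Dt.
have De x : D (e ** x) = e ** D x by rewrite DM De0 mul0l add0r.
have Dpr1 x : D (pr1 x) = pr1 (D x) by rewrite /pr1 linearB linearMn !De.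
have Dprh x : D (prh x) = prh (D x) by rewrite /prh linearMn linearB !De.
have Dpr0 x : D (pr0 x) = pr0 (D x).
  by rewrite /pr0 linearD linearB !linearMn /= !De.
have Dt_mul x : D (x ** t) = D x ** t by rewrite DM Dt mul0r addr0.
split=> x y; try apply: val_inj;
  rewrite !(fE, gE, hE, val_comp1, val_comph, val_comp0) -?DM;
  rewrite ?Dpr1 ?Dprh ?Dpr0 //.
- rewrite -Dprh (prh_mul11 (val_in1 x) (val_in1 y)) linearMn /= Dt_mul Dpr1.
  by rewrite scaler_nat.
- rewrite -Dprh (prh_mul00 (val_in0 x) (val_in0 y)) linearMn /= Dt_mul Dpr0.
  by rewrite scaler_nat.
- by have [_ p _] := pr_inh (mul10 (val_in1 x) (val_in0 y)); rewrite -Dprh p.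
- by have [_ p _] := pr_inh (mul1h (val_in1 x) (val_inh y)); rewrite -Dprh p.
- by have [_ p _] := pr_inh (mul0h (val_in0 x) (val_inh y)); rewrite -Dprh p.
Qed.

End Quadruplets.

Lemma quadruplet_exists (d : {linear A -> A}) : derivation mul d ->
  exists (f : peirce_end mul e 2%:R^-1) (g : peirce_end mul e 0)
         (h : peirce_end mul e 1),
    described_by f g h d (d e) /\ compatible f g h t.
Proof.
move=> dM; have [ha dt] := derivation_half dM.
have [D DE] : exists D : {linear A -> A}, D =1 fun x => d x - inner (d e) x.
  apply: linear_bundle => k x y.
  by rewrite linearP inner_linear scalerBr; module.
have DM : derivation mul D.
  by move=> x y; rewrite !DE dM inner_derivation !mulE; module.
have De0 : D e = 0 by rewrite DE inner_e ?subrr.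
have De x : D (e ** x) = e ** D x by rewrite DM De0 mul0l add0r.
have Dt : D t = 0.
  rewrite DE dt /inner.
  have -> : d e ** (e ** t) = 0.
    by apply: double_inj; rewrite -mulMnr et mulC mul_th.
  by rewrite (mulC (d e)) mul_th // mul0r; module.
have [f fE] := restrict_end 2%:R^-1 De.
have [g gE] := restrict_end 0 De.
have [h hE] := restrict_end 1 De.
exists f, g, h; split; last exact: (@compatible_derivation D).
by apply: (@described_inner D) => // x; rewrite DE subrK.
Qed.

(** By commutativity, six of the nine pairs of Peirce spaces suffice. *)
Lemma derivation_by_eigen (D : {linear A -> A}) :
  (forall x y, in1 x -> in1 y -> D (x ** y) = D x ** y + x ** D y) ->
  (forall x y, inh x -> inh y -> D (x ** y) = D x ** y + x ** D y) ->
  (forall x y, in0 x -> in0 y -> D (x ** y) = D x ** y + x ** D y) ->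
  (forall x y, in1 x -> inh y -> D (x ** y) = D x ** y + x ** D y) ->
  (forall x y, in1 x -> in0 y -> D (x ** y) = D x ** y + x ** D y) ->
  (forall x y, in0 x -> inh y -> D (x ** y) = D x ** y + x ** D y) ->
  derivation mul D.
Proof.
move=> D11 Dhh D00 D1h D10 D0h x y.
have sym (P Q : A -> Prop) :
    (forall x y, P x -> Q y -> D (x ** y) = D x ** y + x ** D y) ->
    forall x y, Q x -> P y -> D (x ** y) = D x ** y + x ** D y.
  move=> DPQ u v Qu Pv.
  by rewrite mulC (DPQ _ _ Pv Qu) addrC !(mulC v) (mulC _ u).
rewrite (pr_sum x) (pr_sum y).
have := (in1_pr1 x, inh_prh x, in0_pr0 x).
have := (in1_pr1 y, inh_prh y, in0_pr0 y).
move: (pr1 x) (prh x) (pr0 x) (pr1 y) (prh y) (pr0 y).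
move=> x1 xh x0 y1 yh y0 [[hy1 hyh] hy0] [[hx1 hxh] hx0].
rewrite !mulE !(linearD D) /= !mulE.
rewrite (D11 _ _ hx1 hy1) (Dhh _ _ hxh hyh) (D00 _ _ hx0 hy0).
rewrite (D1h _ _ hx1 hyh) (D10 _ _ hx1 hy0) (D0h _ _ hx0 hyh).
rewrite (sym _ _ D1h _ _ hxh hy1) (sym _ _ D10 _ _ hx0 hy1).
rewrite (sym _ _ D0h _ _ hxh hy0).
by module.
Qed.

(** The map [D] assembled from h, f, g is a derivation killing e; adding [inner a] moves its value
    at e to a. *)
Lemma derivation_exists a (f : peirce_end mul e 2%:R^-1)
    (g : peirce_end mul e 0) (h : peirce_end mul e 1) :
  inh a -> compatible f g h t ->
  exists d : {linear A -> A}, derivation mul d /\ described_by f g h d a.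
Proof.
move=> ha fgh.
have [D DE] : exists D : {linear A -> A}, D =1 fun x =>
    \val (h (comp1 x)) + \val (f (comph x)) + \val (g (comp0 x)).
  apply: linear_bundle => k x y.
  have [p1 ph p0] := pr_linear k x y.
  have -> : comp1 (k *: x + y) = k *: comp1 x + comp1 y.
    by apply: val_inj; rewrite val_lin !val_comp1.
  have -> : comph (k *: x + y) = k *: comph x + comph y.
    by apply: val_inj; rewrite val_lin !val_comph.
  have -> : comp0 (k *: x + y) = k *: comp0 x + comp0 y.
    by apply: val_inj; rewrite val_lin !val_comp0.
  by rewrite (linearP h) (linearP f) (linearP g) !val_lin !scalerDr; module.
have pr_D x : [/\ pr1 (D x) = \val (h (comp1 x)), prh (D x) = \val (f (comph x))
                & pr0 (D x) = \val (g (comp0 x))].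
  by rewrite DE; apply: pr_eigen.
have hE x : \val (h x) = D (\val x).
  have [p1 ph p0] := pr_in1 (val_in1 x); rewrite DE.
  have -> : comp1 (\val x) = x by apply: val_inj; rewrite val_comp1.
  have -> : comph (\val x) = 0 by apply: val_inj; rewrite val_comph.
  have -> : comp0 (\val x) = 0 by apply: val_inj; rewrite val_comp0.
  by rewrite !linear0 !addr0.
have fE x : \val (f x) = D (\val x).
  have [p1 ph p0] := pr_inh (val_inh x); rewrite DE.
  have -> : comp1 (\val x) = 0 by apply: val_inj; rewrite val_comp1.
  have -> : comph (\val x) = x by apply: val_inj; rewrite val_comph.
  have -> : comp0 (\val x) = 0 by apply: val_inj; rewrite val_comp0.
  by rewrite !linear0 addr0 add0r.
have gE x : \val (g x) = D (\val x).
  have [p1 ph p0] := pr_in0 (val_in0 x); rewrite DE.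
  have -> : comp1 (\val x) = 0 by apply: val_inj; rewrite val_comp1.
  have -> : comph (\val x) = 0 by apply: val_inj; rewrite val_comph.
  have -> : comp0 (\val x) = x by apply: val_inj; rewrite val_comp0.
  by rewrite !linear0 !add0r.
have lift1 x : in1 x -> exists u : A1, \val u = x.
  by move=> hx; exists (Peirce (introT (peirce1P x) hx)).
have lifth x : inh x -> exists u : Ah, \val u = x.
  by move=> hx; exists (Peirce (introT (peircehP x) hx)).
have lift0 x : in0 x -> exists u : A0, \val u = x.
  by move=> hx; exists (Peirce (introT (peirce0P x) hx)).
have h0 w : pr1 w = 0 -> \val (h (comp1 w)) = 0.
  move=> w0; rewrite (_ : comp1 w = 0) ?linear0 //.
  by apply: val_inj; rewrite val_comp1.
have f0 w : prh w = 0 -> \val (f (comph w)) = 0.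
  move=> w0; rewrite (_ : comph w = 0) ?linear0 //.
  by apply: val_inj; rewrite val_comph.
have g0 w : pr0 w = 0 -> \val (g (comp0 w)) = 0.
  move=> w0; rewrite (_ : comp0 w = 0) ?linear0 //.
  by apply: val_inj; rewrite val_comp0.
have D_split w z : \val (h (comp1 w)) = pr1 z -> \val (f (comph w)) = prh z ->
    \val (g (comp0 w)) = pr0 z -> D w = z.
  by rewrite DE => -> -> ->; rewrite -pr_sum.
have D_inh w z z' : inh w -> inh z -> inh z' ->
    \val (f (comph w)) = z + z' -> D w = z + z'.
  move=> hw hz hz' fw; have [w1 _ w0] := pr_inh hw.
  have hzz' : inh (z + z') by rewrite /inh mulDr mulrnDl hz hz'.
  have [z1 zh z0] := pr_inh hzz'.
  by apply: D_split; rewrite ?h0 ?g0 ?z1 ?zh ?z0.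
(* In each case [compatible] settles the components that may be nonzero, and the multiplication
   rules make the others vanish. *)
have DM : derivation mul D.
  apply: derivation_by_eigen => x y.
  - move=> /lift1[{}x <-] /lift1[{}y <-]; rewrite -!hE; apply: D_split.
    + by rewrite (compat1_mul11 fgh) val_comp1.
    + by rewrite (compath_mul11 fgh) val_comph.
    have [z0 _] := mul11 (val_in1 x) (val_in1 y).
    have [zx _] := mul11 (val_in1 (h x)) (val_in1 y).
    have [zy _] := mul11 (val_in1 x) (val_in1 (h y)).
    have [_ _] := pr_linear 1 (\val (h x) ** \val y) (\val x ** \val (h y)).
    by rewrite g0 // !scale1r zx zy addr0.
  - move=> /lifth[{}x <-] /lifth[{}y <-]; rewrite -!fE; apply: D_split.
    + by rewrite (compat1_mulhh fgh) val_comp1.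
    + have zx := mulhh (val_inh (f x)) (val_inh y).
      have zy := mulhh (val_inh x) (val_inh (f y)).
      have [_ + _] := pr_linear 1 (\val (f x) ** \val y) (\val x ** \val (f y)).
      by rewrite f0 ?mulhh ?scale1r ?zx ?zy ?addr0 //; apply: val_inh.
    by rewrite (compat0_mulhh fgh) val_comp0.
  - move=> /lift0[{}x <-] /lift0[{}y <-]; rewrite -!gE; apply: D_split.
    + have [z0 _] := mul00 (val_in0 x) (val_in0 y).
      have [zx _] := mul00 (val_in0 (g x)) (val_in0 y).
      have [zy _] := mul00 (val_in0 x) (val_in0 (g y)).
      have [+ _ _] := pr_linear 1 (\val (g x) ** \val y) (\val x ** \val (g y)).
      by rewrite h0 // !scale1r zx zy addr0.
    + by rewrite (compath_mul00 fgh) val_comph.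
    by rewrite (compat0_mul00 fgh) val_comp0.
  - move=> /lift1[{}x <-] /lifth[{}y <-]; rewrite -hE -fE; apply: D_inh.
    + by apply: mul1h; [apply: val_in1 | apply: val_inh].
    + by apply: mul1h; [apply: val_in1 | apply: val_inh].
    + by apply: mul1h; [apply: val_in1 | apply: val_inh].
    by rewrite (compat_mul1h fgh).
  - move=> /lift1[{}x <-] /lift0[{}y <-]; rewrite -hE -gE; apply: D_inh.
    + by apply: mul10; [apply: val_in1 | apply: val_in0].
    + by apply: mul10; [apply: val_in1 | apply: val_in0].
    + by apply: mul10; [apply: val_in1 | apply: val_in0].
    by rewrite (compat_mul10 fgh).
  move=> /lift0[{}x <-] /lifth[{}y <-]; rewrite -gE -fE; apply: D_inh.
  + by apply: mul0h; [apply: val_in0 | apply: val_inh].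
  + by apply: mul0h; [apply: val_in0 | apply: val_inh].
  + by apply: mul0h; [apply: val_in0 | apply: val_inh].
  by rewrite (compat_mul0h fgh).
have De0 : D e = 0.
  have De x : D (e ** x) = e ** D x.
    rewrite [in LHS](comp_sum x) !mulDr (val_in1 (comp1 x)) (val_in0 (comp0 x)).
    rewrite addr0 [in RHS](comp_sum x) !(linearD D) /= -hE -fE -gE !mulDr.
    rewrite (val_in1 (h _)) (val_in0 (g _)) addr0; congr (_ + _).
    apply: double_eq; rewrite -linearMn /= (val_inh (comph x)) -fE.
    by rewrite (val_inh (f _)).
  (* Leibniz gives D(e^2) = 2e D(e), while commutation with L_e gives D(e^2) = e D(e). *)
  have De_mul : e ** D e = 0.
    by have := DM e e; rewrite De (mulC (D e)) => h'; module: (esym h').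
  (* So D(e) is its own 0-component, which is g of the 0-component of e, namely e - 3(e + t) + 2(e +
     (3/2)t) = 0. *)
  have [_ _ <-] := pr_in0 De_mul.
  have [_ _ ->] := pr_D e; apply: g0.
  by rewrite /pr0 ee mulDr ee; module: et.
have [d dE] : exists d : {linear A -> A}, d =1 fun x => D x + inner a x.
  apply: linear_bundle => k x y.
  by rewrite linearP inner_linear (scalerDr k (D x)); module.
exists d; split; last exact: (@described_inner D).
by move=> x y; rewrite !dE DM inner_derivation !mulE; module.
Qed.

End PseudoIdempotent.
End LieTriple.

Theorem theorem3p6 (K : fieldType)
  (char2 : 2%N \notin [pchar K]) (char3 : 3%N \notin [pchar K])
  (A : lmodType K) (mul : {bilinear A -> A -> A})
  (lieA : lie_triple_algebra mul)
  (e t : A) (pseudo_e : pseudo_idempotent mul e t) :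
  [/\
    forall d : {linear A -> A}, derivation mul d ->
      exists (f : peirce_end mul e 2%:R^-1) (g : peirce_end mul e 0)
             (h : peirce_end mul e 1),
        described_by f g h d (d e) /\ compatible f g h t,
    forall d : {linear A -> A}, derivation mul d ->
      forall (f f' : peirce_end mul e 2%:R^-1) (g g' : peirce_end mul e 0)
             (h h' : peirce_end mul e 1),
        described_by f g h d (d e) -> compatible f g h t ->
        described_by f' g' h' d (d e) -> compatible f' g' h' t ->
        [/\ f =1 f', g =1 g' & h =1 h'],
    forall d d' : {linear A -> A}, derivation mul d -> derivation mul d' ->
      forall (a : A) (f : peirce_end mul e 2%:R^-1) (g : peirce_end mul e 0)
             (h : peirce_end mul e 1),
        described_by f g h d a -> described_by f g h d' a -> d =1 d'
  & forall (a : A) (f : peirce_end mul e 2%:R^-1) (g : peirce_end mul e 0)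
           (h : peirce_end mul e 1),
      a \in peirce_pred mul e 2%:R^-1 -> compatible f g h t ->
      exists d : {linear A -> A}, derivation mul d /\ described_by f g h d a].
Proof.
have half a : a \in peirce_pred mul e 2%:R^-1 -> inh mul e a.
  by move/peircehP; apply.
split.
- exact: quadruplet_exists.
- move=> d _ f f' g g' h h' [_ _ d1 dh d0] _ [_ _ d1' dh' d0'] _.
  (* The terms in [d e] are common to both descriptions and cancel. *)
  split=> x; apply: val_inj.
  + by move: (dh x); rewrite dh' => /addIr/addIr.
  + by move: (d0 x); rewrite d0' => /addIr.
  + by move: (d1 x); rewrite d1' => /addIr.
- move=> d d' _ _ a f g h [_ _ d1 dh d0] [_ _ d1' dh' d0'] x.
  rewrite (comp_sum char2 char3 lieA pseudo_e x) !linearD /=.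
  by rewrite d1 dh d0 d1' dh' d0'.
by move=> a f g h /half ha; apply: derivation_exists.
Qed.
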